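(* Let $G=(V,E)$ be a graph, let $(G,p)$ be a generic complex realisation of $G$, and let $u,v,v_1,v_2,v_3,v_n\in V$ with $N(v_n)=\{v_1,v_2,v_3\}$ and $v_n\ne u,v$. Let $H=G-v_n+v_1v_2$. Suppose that $G-v_n$ is rigid and that $\{u,v\}$ is globally linked in $(H,p|_{V-v_n})$. Then $\{u,v\}$ is globally linked in $(G,p)$.
   Context: A complex realisation of a finite graph $G=(V,E)$ is a map $p:V\to\mathbb{C}^2$. For $P=(x,y)\in\mathbb{C}^2$ put $d(P)=x^2+y^2$. Realisations $(G,p),(G,q)$ are equivalent if $d(p(u)-p(v))=d(q(u)-q(v))$ for all $uv\in E$. A realisation is generic if the set of all coordinates of the points $p(v)$ is algebraically independent over $\mathbb{Q}$. The rigidity matrix $R(G,p)$ is the $|E|\times2|V|$ matrix whose row for edge $uv$ has $p(u)-p(v)$ in the columns of $u$, $p(v)-p(u)$ in the columns of $v$, zeros elsewhere; a graph is rigid if $\operatorname{rank}R(G,p)=2|V|-3$ for a generic real realisation $p$. For a complex realisation $(G,p)$ and $u,v\in V$, the pair $\{u,v\}$ is globally linked in $(G,p)$ if every complex realisation $(G,q)$ equivalent to $(G,p)$ satisfies $d(p(u)-p(v))=d(q(u)-q(v))$. *)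

(* Defs.v *)
From HB Require Import structures.
From mathcomp Require Import all_boot all_order all_algebra.
From mathcomp Require Import Rstruct complex.
From mathcomp Require Import mpoly.
Set Implicit Arguments. Unset Strict Implicit. Unset Printing Implicit Defensive.
Import Order.TTheory GRing.Theory Num.Theory.
Local Open Scope ring_scope.

Notation RR := Rdefinitions.R.
Notation CC := (complex Rdefinitions.R).

Definition d {F : numFieldType} (P : 'rV[F]_2) : F :=
  P ord0 ord0 ^+ 2 + P ord0 (lift ord0 ord0) ^+ 2.

Definition alg_indep_Q {F : numFieldType} {I : finType} (x : I -> F) : Prop :=
  forall P : {mpoly rat[#|I|]},
    (map_mpoly (ratr : rat -> F) P).@[fun i => x (enum_val i)] = 0 -> P = 0.

(* A graph is given by a vertex set Vs : {set T} (T a finite type) and an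
   edge relation E : rel T (symmetric, irreflexive, only between vertices
   of Vs).  A realisation of such a graph in F^2 is a map p : T -> 'rV[F]_2;
   only its values on Vs matter. *)

Definition generic {F : numFieldType} {T : finType} (Vs : {set T})
    (p : T -> 'rV[F]_2) : Prop :=
  alg_indep_Q (fun i : {v : T | v \in Vs} * 'I_2 => p (val i.1) ord0 i.2).

Definition equivalent {F : numFieldType} {T : finType} (E : rel T)
    (p q : T -> 'rV[F]_2) : Prop :=
  forall a b, E a b -> d (p a - p b) = d (q a - q b).

Definition globally_linked {T : finType} (E : rel T) (p : T -> 'rV[CC]_2)
    (u v : T) : Prop :=
  forall q : T -> 'rV[CC]_2, equivalent E p q -> d (p u - p v) = d (q u - q v).

(* Rigidity matrix: rows indexed by ordered pairs (a,b) of vertices (row is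
   zero unless ab is an edge; the two orientations of an edge give rows that
   are negatives of each other, so the rank equals that of the usual
   |E| x 2|V| matrix), columns indexed by (vertex, coordinate). The row of
   edge ab has p(a)-p(b) in the columns of a, p(b)-p(a) in those of b. *)
Definition rigidity_matrix {F : numFieldType} {T : finType} (E : rel T)
    (p : T -> 'rV[F]_2) : 'M[F]_(#|{: T * T}|, #|{: T * 'I_2}|) :=
  \matrix_(i, j)
    let ab := enum_val i in let wk := enum_val j in
    if E ab.1 ab.2 then
      (p ab.1 ord0 wk.2 - p ab.2 ord0 wk.2) *
        ((wk.1 == ab.1)%:R - (wk.1 == ab.2)%:R)
    else 0.

Definition rigid {T : finType} (Vs : {set T}) (E : rel T) : Prop :=
  exists p : T -> 'rV[RR]_2,
    generic Vs p /\ \rank (rigidity_matrix E p) = (2 * #|Vs| - 3)%N.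

Definition del_vertex {T : finType} (E : rel T) (w : T) : rel T :=
  fun a b => [&& E a b, a != w & b != w].

Definition add_edge {T : finType} (E : rel T) (x y : T) : rel T :=
  fun a b => [|| E a b, (a == x) && (b == y) | (a == y) && (b == x)].

(* Main.v *)
(* Let [q] be equivalent to [p]; it suffices to show that [q] and [p] give the
   pair [v1, v2] the same distance.  As [p] is generic, every velocity of [p] is
   the value at [p] of a derivation of Q(p), which extends to Q(p, q); so every
   velocity of [p] has a response of [q] inducing the same first-order change of
   all edge lengths.  Hence the rigidity matrix of [q] on [G - vn] has at least
   the rank of that of [p], and [q] is infinitesimally rigid there.  Moving only
   [p vn], the response of [q] may therefore be assumed to move only [q vn],
   which gives a linear map sending [q vn - q vi] to [p vn - p vi] for
   [i = 1, 2, 3].  It preserves the squared length of these three vectors, no two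
   of which are parallel, hence it is an isometry and preserves
   [d (q v1 - q v2)]. *)
From mathcomp Require Import mpoly ring zify.
From HB Require Import structures.
From Stdlib Require Import Classical.
Require Import Defs.
From mathcomp Require Import all_boot all_order all_algebra.
From mathcomp Require Import Rstruct complex.
Set Implicit Arguments. Unset Strict Implicit. Unset Printing Implicit Defensive.
Import GRing.Theory Num.Theory.
Local Open Scope ring_scope.

Local Notation i0 := (@ord0 1).
Local Notation i1 := (lift (@ord0 1) (@ord0 0)).

(** * Extension of derivations inside a field of characteristic zero *)

(* When [delta] moreover vanishes on the kernel of [phi], the pair encodes a
   derivation of the subring [phi R] of [F] with values in [F]. *)
Definition leibniz (R : comNzRingType) (F : fieldType) (phi delta : R -> F) :=
  forall a b, delta (a * b) = phi a * delta b + phi b * delta a.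

Lemma map_poly_leibniz (R : idomainType) (F : fieldType)
    (phi : {rmorphism R -> F}) (delta : {additive R -> F}) (P Q : {poly R}) :
  leibniz phi delta ->
  map_poly delta (P * Q) =
    map_poly phi P * map_poly delta Q + map_poly phi Q * map_poly delta P.
Proof.
move=> leib; rewrite (mulrC (map_poly phi Q)); apply/polyP=> i.
rewrite coef_map coefD !coefM.
rewrite raddf_sum -big_split; apply: eq_bigr => j _ /=.
by rewrite !coef_map leib [X in _ + X]mulrC.
Qed.

Lemma exists_minimal_size (R : nzRingType) (B : {poly R} -> Prop) (P : {poly R}) :
  B P -> exists2 M, B M & forall Q, B Q -> (size M <= size Q)%N.
Proof.
have [n] := ubnP (size P); elim: n P => // n IHn P ltPn BP.
have [[Q [BQ ltQP]]|noQ] := classic (exists Q, B Q /\ (size Q < size P)%N).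
  by apply: (IHn Q) => //; apply: leq_trans ltQP _.
exists P => // Q BQ; rewrite leqNgt; apply/negP=> ltQP.
by apply: noQ; exists Q.
Qed.

(* If [M] of minimal size represents an algebraic relation of [t] over [phi R],
   the value at [t] is forced by [delta' M = 0]; pseudo-division by [M] shows that
   this choice kills all other relations. *)
Lemma derivation_extend1 (R : idomainType) (F : numFieldType)
    (phi : {rmorphism R -> F}) (delta : {additive R -> F}) (t : F) :
  leibniz phi delta -> (forall a, phi a = 0 -> delta a = 0) ->
  exists delta' : {additive {poly R} -> F},
    [/\ leibniz (horner_eval t \o map_poly phi) delta',
        forall P, (map_poly phi P).[t] = 0 -> delta' P = 0
      & forall a, delta' a%:P = delta a].
Proof.
move=> leib ker.
(* The extension of [delta] to polynomials that takes the value [dt] at the indeterminate. *)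
pose D dt : {additive {poly R} -> F} :=
  (horner_eval t \o map_poly delta) \+
  (dt \*o (horner_eval t \o deriv \o map_poly phi)).
have DE dt P : D dt P =
    (map_poly delta P).[t] + dt * (map_poly phi P)^`().[t] by [].
have Dleib dt : leibniz (horner_eval t \o map_poly phi) (D dt).
  move=> P Q; rewrite !DE /= /horner_eval (map_poly_leibniz _ _ leib) rmorphM derivM.
  by rewrite !(hornerD, hornerM); ring.
have DC dt a : D dt a%:P = delta a.
  by rewrite DE !map_polyC derivC !hornerC mulr0 addr0.
have Dmap0 dt P : map_poly phi P = 0 -> D dt P = 0.
  move=> P0; rewrite DE P0 deriv0 horner0 mulr0 addr0.
  suff -> : map_poly delta P = 0 by rewrite horner0.
  apply/polyP=> i; rewrite coef_map coef0 /=; apply: ker.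
  by rewrite -coef_map P0 coef0.
suff [dt Ddt]: exists dt, forall P, (map_poly phi P).[t] = 0 -> D dt P = 0.
  by exists (D dt); split.
pose bad P := map_poly phi P != 0 /\ (map_poly phi P).[t] = 0.
have [[P badP]|nobad] := classic (exists P, bad P); last first.
  (* Here [t] is transcendental over the image of [phi], so any value would do. *)
  exists 0 => P Pt; apply: Dmap0; apply/eqP/negPn/negP => Pn0.
  by apply: nobad; exists P.
have [M [Mn0 Mt] minM] := exists_minimal_size badP.
have small0 (Q : {poly R}) : (size Q < size M)%N -> (map_poly phi Q).[t] = 0 ->
    map_poly phi Q = 0.
  move=> ltQM Qt; apply/eqP/negPn/negP => Qn0.
  by have := minM Q (conj Qn0 Qt); rewrite leqNgt ltQM.
have M_n0 : M != 0 by apply: contraNneq Mn0 => ->; rewrite rmorph0.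
(* Otherwise dropping the leading term of [M] leaves its image unchanged and gives a shorter bad
   polynomial. *)
have lcM : phi (lead_coef M) != 0.
  apply/eqP=> lc0; pose N := take_poly (size M).-1 M.
  have eN : map_poly phi N = map_poly phi M.
    apply/polyP=> i; rewrite !coef_map coef_take_poly /=.
    case: ltngtP => // [lti|->]; last by rewrite rmorph0 -lead_coefE lc0.
    rewrite rmorph0 nth_default ?rmorph0 //; move: lti.
    by case: (size M).
  have /minM : bad N by rewrite /bad eN.
  rewrite leqNgt /N (leq_ltn_trans (size_take_poly _ _)) //.
  by rewrite ltn_predL lt0n size_poly_eq0.
have szM : size (map_poly phi M) = size M by rewrite size_map_poly_id0.
have szM1 : (1 < size M)%N.
  rewrite -szM; apply: (@root_size_gt1 _ t) => //; exact/rootP.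
(* If the derivative of [M] vanished at [t], minimality would make its image zero; in characteristic
   zero its top coefficient has nonzero image. *)
have dMt : (map_poly phi M)^`().[t] != 0.
  apply/eqP=> dM0; have /small0: (size M^`() < size M)%N by rewrite lt_size_deriv.
  rewrite -deriv_map => /(_ dM0) dM; move: lcM szM1.
  rewrite lead_coefE -coef_map; case: (size M) => [|[|k]] //= lcM _.
  have /eqP := congr1 (fun p : {poly F} => p`_k) dM.
  by rewrite coef_deriv coef0 mulrn_eq0 (negPf lcM).
exists (- (map_poly delta M).[t] / (map_poly phi M)^`().[t]).
set dt := _ / _.
have DM : D dt M = 0 by rewrite DE /dt divfK // subrr.
move=> G Gt; have E := Pdiv.Idomain.divp_eq G M.
set c := lead_coef M ^+ _ in E; set A := Pdiv.Idomain.divp _ _ in E.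
set N := Pdiv.Idomain.modp _ _ in E.
have ltN : (size N < size M)%N by rewrite Pdiv.Idomain.ltn_modp.
have phiN : map_poly phi N = 0.
  apply: small0 => //; have := congr1 (horner_eval t \o map_poly phi) E.
  rewrite -mul_polyC rmorphD !rmorphM /= /horner_eval Gt Mt !mulr0 add0r.
  by move=> <-.
have := congr1 (D dt) E; rewrite -mul_polyC raddfD !Dleib (Dmap0 dt N phiN) DM.
rewrite /= /horner_eval Gt Mt !mul0r mulr0 !addr0 map_polyC hornerC => /eqP.
by rewrite /c /= (rmorphXn phi) mulf_eq0 expf_eq0 (negPf lcM) andbF => /eqP.
Qed.

(** One indeterminate is adjoined for each element of [ts]. Working with rings mapped to [F], rather
    than with subfields of [F], keeps every step a polynomial extension. *)
Lemma derivation_extend (F : numFieldType) (ts : seq F) (R : idomainType)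
    (phi : {rmorphism R -> F}) (delta : {additive R -> F}) :
  leibniz phi delta -> (forall a, phi a = 0 -> delta a = 0) ->
  exists (R' : idomainType) (phi' : {rmorphism R' -> F})
      (delta' : {additive R' -> F}) (iota : R -> R'),
    [/\ leibniz phi' delta', forall a, phi' a = 0 -> delta' a = 0,
        forall a, phi' (iota a) = phi a /\ delta' (iota a) = delta a
      & forall t, t \in ts -> exists a, phi' a = t].
Proof.
elim: ts R phi delta => [|t ts IHts] R phi delta leib ker.
  by exists R, phi, delta, id.
have [delta1 [leib1 ker1 d1]] := derivation_extend1 t leib ker.
have [R' [phi' [delta' [iota [leib' ker' ext surj]]]]] := IHts _ _ _ leib1 ker1.
exists R', phi', delta', (iota \o polyC); split=> // [a|s].
  have [/= -> ->] := ext a%:P.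
  by rewrite d1 /= /horner_eval map_polyC hornerC.
rewrite inE => /predU1P[->|/surj//]; exists (iota 'X).
by have [-> _] := ext 'X; rewrite /= /horner_eval map_polyX hornerX.
Qed.

(** * Derivations with prescribed values at algebraically independent points *)

Definition ratr_eval (F : numFieldType) n (x : 'I_n -> F) :
    {rmorphism {mpoly rat[n]} -> F} :=
  meval x \o map_mpoly (ratr : rat -> F).

Lemma ratr_evalX (F : numFieldType) n (x : 'I_n -> F) i :
  ratr_eval x 'X_i = x i.
Proof. by rewrite /ratr_eval /= map_mpolyX mevalXU. Qed.

Lemma mderiv_leibniz (F : fieldType) n (ev : {rmorphism {mpoly rat[n]} -> F})
    (y : 'I_n -> F) :
  leibniz ev (fun P => \sum_i ev P^`M(i) * y i).
Proof.
move=> P Q; rewrite !mulr_sumr -big_split; apply: eq_bigr => i _ /=.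
rewrite mderivM rmorphD (rmorphM ev) (rmorphM ev).
by rewrite mulrDl addrC (mulrC (ev P^`M(i))) !mulrA.
Qed.

(** Independence makes evaluation at [x] injective on rational polynomials, so the derivation taking
    each indeterminate to [y i] trivially kills the kernel and can be extended to [ts]. *)
Lemma derivation_generic (F : numFieldType) n (x y : 'I_n -> F) (ts : seq F) :
  (forall P, ratr_eval x P = 0 -> P = 0) ->
  exists (R : idomainType) (phi : {rmorphism R -> F})
      (delta : {additive R -> F}) (a : 'I_n -> R),
    [/\ leibniz phi delta, forall r, phi r = 0 -> delta r = 0,
        forall i, phi (a i) = x i /\ delta (a i) = y i
      & forall t, t \in ts -> exists r, phi r = t].
Proof.
move=> x_indep.
pose D0 P := \sum_i ratr_eval x (P^`M(i)) * y i.
have D0add : zmod_morphism D0.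
  move=> P Q; rewrite -sumrB; apply: eq_bigr => i _.
  by rewrite mderivB rmorphB mulrBl.
pose D0M := GRing.isZmodMorphism.Build _ _ D0 D0add.
pose D : {additive {mpoly rat[n]} -> F} := HB.pack D0 D0M.
have leib : leibniz (ratr_eval x) D by exact: mderiv_leibniz.
have ker P : ratr_eval x P = 0 -> D P = 0 by move/x_indep->; rewrite raddf0.
have [R [phi [delta [iota [leib' ker' ext surj]]]]] :=
  derivation_extend ts leib ker.
exists R, phi, delta, (fun i => iota 'X_i); split=> // i.
have [-> ->] := ext 'X_i; rewrite ratr_evalX; split=> //.
rewrite -[D _]/(D0 _) /D0 (bigD1 i) // big1 => [|j ji].
  rewrite mderivX mnm1E eqxx (_ : (U_(i) - U_(i) = 0)%MM).
    by rewrite scale1r mpolyX0 (rmorph1 (ratr_eval x)) mul1r [LHS]addr0.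
  by apply/mnmP=> k; rewrite mnmBE mnm0E subnn.
rewrite mderivX mnm1E eq_sym (negPf ji) scale0r.
by rewrite (rmorph0 (ratr_eval x)) mul0r.
Qed.

(** * First-order behaviour of generic realisations *)

Definition dot (F : numFieldType) (P Q : 'rV[F]_2) : F :=
  P ord0 i0 * Q ord0 i0 + P ord0 i1 * Q ord0 i1.

Section GenericPoints.
Variables (F : numFieldType) (T : finType).

Let I : finType := ({v : T | v \in [set: T]} * 'I_2)%type.

Definition coord_index (v : T) (k : 'I_2) : 'I_#|I| :=
  enum_rank (exist (fun v => v \in [set: T]) v (in_setT v), k).

Definition coord_at (F' : numFieldType) (p : T -> 'rV[F']_2) (i : 'I_#|I|) : F' :=
  p (val (enum_val i).1) ord0 (enum_val i).2.

Lemma coord_atE (F' : numFieldType) (p : T -> 'rV[F']_2) v k :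
  coord_at p (coord_index v k) = p v ord0 k.
Proof. by rewrite /coord_at enum_rankK. Qed.

Lemma generic_eval_inj (p : T -> 'rV[F]_2) P :
  generic [set: T] p -> ratr_eval (coord_at p) P = 0 -> P = 0.
Proof. by move=> gen_p; apply: gen_p. Qed.

(** A derivation taking the coordinates of [p] to those of [P] is extended to the coordinates of
    [q]; its values there form [Q]. Differentiating the equality of squared edge lengths gives the
    claim. *)
Lemma generic_first_order (E : rel T) (p q P : T -> 'rV[F]_2) :
  generic [set: T] p -> equivalent E p q ->
  exists Q : T -> 'rV[F]_2, forall a b, E a b ->
    dot (p a - p b) (P a - P b) = dot (q a - q b) (Q a - Q b).
Proof.
move=> gen_p eq_pq.
have [R [phi [delta [x [leib ker xE surj]]]]] :=
  derivation_generic (coord_at P) (codom (fun vk : T * 'I_2 => q vk.1 ord0 vk.2))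
    (fun P => generic_eval_inj (P := P) gen_p).
have /fin_all_exists[y yE] : forall vk : T * 'I_2, exists r, phi r = q vk.1 ord0 vk.2.
  by move=> vk; apply/surj/codom_f.
exists (fun v => \row_k delta (y (v, k))) => a b Eab.
pose sq r := r * r : R.
have dsq r : delta (sq r) = 2 * (phi r * delta r) by rewrite leib; ring.
(* [r] represents the difference of the squared lengths of [ab] in [p] and in [q], so [phi r = 0];
   then [delta r = 0] is twice the desired equality. *)
pose r : R := sq (x (coord_index a i0) - x (coord_index b i0))
  + sq (x (coord_index a i1) - x (coord_index b i1))
  - (sq (y (a, i0) - y (b, i0)) + sq (y (a, i1) - y (b, i1))).
have phi_x v k : phi (x (coord_index v k)) = p v ord0 k.
  by have [-> _] := xE (coord_index v k); rewrite coord_atE.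
have delta_x v k : delta (x (coord_index v k)) = P v ord0 k.
  by have [_ ->] := xE (coord_index v k); rewrite coord_atE.
have /ker : phi r = 0.
  rewrite !(rmorphB, rmorphD, rmorphM) /= !phi_x !yE /=.
  have := eq_pq a b Eab; rewrite /d !mxE !expr2 => ->; exact: subrr.
rewrite !(raddfB, raddfD) /= !dsq !raddfB /= !phi_x !delta_x !yE /= /dot !mxE.
move=> dr; apply: (@mulfI _ 2); first by rewrite pnatr_eq0.
by apply/eqP; rewrite -subr_eq0; apply/eqP; rewrite -[RHS]dr; ring.
Qed.

Lemma generic_poly_neq0 (p p0 : T -> 'rV[F]_2) P :
  generic [set: T] p -> ratr_eval (coord_at p0) P != 0 ->
  ratr_eval (coord_at p) P != 0.
Proof.
move=> gen_p; apply: contraNneq => /(generic_eval_inj gen_p) ->.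
by rewrite (rmorph0 (ratr_eval _)).
Qed.

End GenericPoints.

(** * Comparison of ranks of rigidity matrices *)

(** A maximal minor that is nonzero under [f] is nonzero in [R], hence under the injective [g]. *)
Lemma mxrank_map_le (R : comNzRingType) (F1 F2 : fieldType)
    (f : {rmorphism R -> F1}) (g : {rmorphism R -> F2}) m n (M : 'M[R]_(m, n)) :
  (forall a, g a = 0 -> a = 0) ->
  (\rank (map_mx f M) <= \rank (map_mx g M))%N.
Proof.
move=> g_inj; set k := maxrankfun (map_mx f M).
have kfull : row_full (rowsub k (map_mx f M))^T.
  by rewrite /row_full mxrank_tr; apply: maxrowsub_free.
set h := fullrankfun kfull; pose N := rowsub h (rowsub k M)^T.
have detN : \det (map_mx f N) != 0.
  have := fullrowsub_unit kfull; rewrite unitmxE unitfE.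
  by rewrite /N map_mxsub -map_trmx map_mxsub.
have gN : map_mx g N \in unitmx.
  rewrite unitmxE unitfE det_map_mx; apply: contra_neq detN => /g_inj.
  by rewrite det_map_mx => ->; rewrite rmorph0.
have <- := mxrank_unit gN.
rewrite /N map_mxsub -map_trmx map_mxsub.
by rewrite (leq_trans (mxrankS (rowsub_sub _ _))) // mxrank_tr mxrankS // rowsub_sub.
Qed.

Section RigidityMatrix.
Variables (T : finType).

Definition velocity_col (F : numFieldType) (P : T -> 'rV[F]_2) : 'cV[F]_#|{: T * 'I_2}| :=
  \col_j P (enum_val j).1 ord0 (enum_val j).2.

Lemma rigidity_matrix_mul (F : numFieldType) (E : rel T) (p P : T -> 'rV[F]_2) i :
  (rigidity_matrix E p *m velocity_col P) i ord0 =
  let ab := enum_val i in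
  if E ab.1 ab.2 then dot (p ab.1 - p ab.2) (P ab.1 - P ab.2) else 0.
Proof.
have sum_delta (f : T -> F) a : \sum_v (v == a)%:R * f v = f a.
  rewrite (bigD1 a) //= eqxx mul1r big1 ?addr0 // => v /negPf ->.
  by rewrite mul0r.
rewrite mxE; under eq_bigr do rewrite !mxE /=.
case: (enum_val i) => a b /=.
rewrite -(big_enum_val (A := predT) (fun wk : T * 'I_2 =>
  (if E a b then (p a ord0 wk.2 - p b ord0 wk.2) *
     ((wk.1 == a)%:R - (wk.1 == b)%:R) else 0) * P wk.1 ord0 wk.2)).
case: ifP => _; last by rewrite big1 // => vk _; rewrite mul0r.
rewrite -(pair_big xpredT xpredT (fun v k => (p a ord0 k - p b ord0 k) *
  ((v == a)%:R - (v == b)%:R) * P v ord0 k)) exchange_big /=.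
have sum_k k : \sum_v (p a ord0 k - p b ord0 k) *
    ((v == a)%:R - (v == b)%:R) * P v ord0 k =
    (p a - p b) ord0 k * (P a - P b) ord0 k.
  under eq_bigr do rewrite -mulrA (mulrBl (P _ _ _)).
  by rewrite -mulr_sumr sumrB !sum_delta !mxE.
by rewrite !big_ord_recl big_ord0 addr0 !sum_k.
Qed.

Lemma eq_mul_velocity_col (F : numFieldType) (E : rel T)
    (p q P Q : T -> 'rV[F]_2) :
  (forall a b, E a b ->
    dot (p a - p b) (P a - P b) = dot (q a - q b) (Q a - Q b)) ->
  rigidity_matrix E p *m velocity_col P = rigidity_matrix E q *m velocity_col Q.
Proof.
move=> eqPQ; apply/colP=> i; rewrite !rigidity_matrix_mul /=.
by case: ifP => // /eqPQ.
Qed.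

(** By the first-order response, each column of the matrix of [p] is the image of some velocity
    under the matrix of [q], so the column spaces are nested. *)
Lemma rank_rigidity_equivalent (F : numFieldType) (E : rel T)
    (p q : T -> 'rV[F]_2) :
  generic [set: T] p -> equivalent E p q ->
  (\rank (rigidity_matrix E p) <= \rank (rigidity_matrix E q))%N.
Proof.
move=> gen_p eq_pq; rewrite -mxrank_tr -(mxrank_tr (rigidity_matrix E q)).
apply/mxrankS/row_subP => j; rewrite -tr_col colE.
pose P v : 'rV[F]_2 := \row_k ((v, k) == enum_val j)%:R.
have [Q /eq_mul_velocity_col PQ] := generic_first_order P gen_p eq_pq.
have -> : delta_mx j 0 = velocity_col P.
  apply/colP=> i; rewrite !mxE -surjective_pairing eqxx andbT.
  by rewrite (inj_eq enum_val_inj).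
by rewrite PQ trmx_mul submxMl.
Qed.

(** Both matrices specialise one matrix of rational polynomials, and specialisation at [p] is
    injective. The two fields may differ: rigidity is tested over the reals, while [p] is
    complex. *)
Lemma rank_rigidity_generic (F F0 : numFieldType) (E : rel T)
    (p : T -> 'rV[F]_2) (p0 : T -> 'rV[F0]_2) :
  generic [set: T] p ->
  (\rank (rigidity_matrix E p0) <= \rank (rigidity_matrix E p))%N.
Proof.
move=> gen_p.
pose M : 'M[{mpoly rat[_]}]_(#|{: T * T}|, #|{: T * 'I_2}|) := \matrix_(i, j)
  let ab := enum_val i in let wk := enum_val j in
  if E ab.1 ab.2 then
    ('X_(coord_index ab.1 wk.2) - 'X_(coord_index ab.2 wk.2)) *
      ((wk.1 == ab.1)%:R - (wk.1 == ab.2)%:R)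
  else 0.
have evM (F' : numFieldType) (p' : T -> 'rV[F']_2) :
    rigidity_matrix E p' = map_mx (ratr_eval (coord_at p')) M.
  apply/matrixP=> i j; rewrite !mxE; cbv zeta.
  case: ifP => _; last by rewrite (rmorph0 (ratr_eval _)).
  rewrite (rmorphM (ratr_eval _)) !(rmorphB (ratr_eval _)).
  by rewrite !ratr_evalX !coord_atE !(rmorph_nat (ratr_eval _)).
rewrite !evM; apply: mxrank_map_le => P; exact: generic_eval_inj.
Qed.

End RigidityMatrix.

(** * Infinitesimal motions of a rigid graph with one isolated vertex *)

Lemma row2P (F : numFieldType) (u w : 'rV[F]_2) :
  u ord0 i0 = w ord0 i0 -> u ord0 i1 = w ord0 i1 -> u = w.
Proof.
move=> e0 e1; apply/rowP=> k; case: (unliftP i0 k) => [j|] -> //.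
by rewrite (ord1 j).
Qed.

Definition rot90 (F : numFieldType) (u : 'rV[F]_2) : 'rV[F]_2 :=
  \row_k (if k == i0 then - u ord0 i1 else u ord0 i0).

Section Motions.
Variables (F : numFieldType) (T : finType) (E : rel T) (n : T).
Variable (q : T -> 'rV[F]_2).
Hypothesis E_n : forall x y, E x y -> x != n /\ y != n.

(* The last two motions displace only the isolated vertex [n]. *)
Definition basic_motion (i : 'I_5) (v : T) : 'rV[F]_2 :=
  match val i with
  | 0 => delta_mx ord0 i0
  | 1 => delta_mx ord0 i1
  | 2 => rot90 (q v)
  | 3 => (v == n)%:R *: delta_mx ord0 i0
  | _ => (v == n)%:R *: delta_mx ord0 i1
  end.

Definition basic_motions : 'M[F]_(5, #|{: T * 'I_2}|) :=
  \matrix_i (velocity_col (basic_motion i))^T.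

Lemma mul_basic_motions (u : 'rV[F]_5) :
  exists (c f : 'rV[F]_2) (theta : F),
    (forall v, \row_k (u *m basic_motions) ord0 (enum_rank (v, k)) =
       c + theta *: rot90 (q v) + (v == n)%:R *: f) /\
    (c = 0 -> theta = 0 -> f = 0 -> u = 0).
Proof.
exists (\row_k (if k == i0 then u ord0 (inord 0) else u ord0 (inord 1))).
exists (\row_k (if k == i0 then u ord0 (inord 3) else u ord0 (inord 4))).
exists (u ord0 (inord 2)); split=> [v|/rowP c0 t0 /rowP f0].
  have E5 (f : 'I_5 -> F) : \sum_i f i =
      f (inord 0) + f (inord 1) + f (inord 2) + f (inord 3) + f (inord 4).
    rewrite !big_ord_recl big_ord0 addr0 !addrA.
    by do !congr (_ + _); congr f; apply: val_inj; rewrite /= inordK.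
  apply: row2P; rewrite !mxE E5 !mxE enum_rankK /basic_motion /= !inordK //= !mxE /=;
    ring.
apply/rowP=> i; rewrite mxE.
have := c0 i0; have := c0 i1; have := f0 i0; have := f0 i1; rewrite !mxE /=.
move=> f01 f00 c01 c00; rewrite -(inord_val i).
by case: i => [[|[|[|[|[|i]]]]] lti].
Qed.

Lemma basic_motions_rigidity : basic_motions *m (rigidity_matrix E q)^T = 0.
Proof.
apply/row_matrixP=> i; rewrite row_mul rowK row0 -trmx_mul.
apply: (can_inj (@trmxK _ _ _)); rewrite trmxK trmx0.
apply/colP=> e; rewrite rigidity_matrix_mul mxE /=.
case: (enum_val e) => a b /=; case: ifP => // /E_n[an bn].
rewrite /dot !mxE /basic_motion.
case: i => [[|[|[|[|i]]]] lti] /=; rewrite !mxE /= ?(negPf an) ?(negPf bn) /=; ring.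
Qed.

(** Dimension count: the five basic motions are independent, and the rank bound leaves a space of
    motions of dimension at most five, so they span it. *)
Lemma motion_trivial (Q : T -> 'rV[F]_2) :
  (5 < 2 * #|T|)%N -> (2 * #|T| <= \rank (rigidity_matrix E q) + 5)%N ->
  (forall a b, E a b -> dot (q a - q b) (Q a - Q b) = 0) ->
  exists (c : 'rV[F]_2) (theta : F),
    forall v, v != n -> Q v = c + theta *: rot90 (q v).
Proof.
move=> T_gt rankR motQ.
(* An edge with distinct end points makes the rotation independent of the translations; without one
   the rank would be zero, against the bounds. *)
have [[a [b [Eab qab]]]|const_q] :=
    classic (exists a b, E a b /\ q a != q b); last first.
  suff R0 : rigidity_matrix E q = 0.
    by move: rankR; rewrite R0 mxrank0; lia.
  apply/matrixP=> i j; rewrite !mxE /=; case: ifP => // Ei.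
  case: (eqVneq (q (enum_val i).1) (q (enum_val i).2)) => [->|qi].
    by rewrite subrr mul0r.
  by case: const_q; exists (enum_val i).1, (enum_val i).2.
have [an bn] := E_n Eab.
have free_N : row_free basic_motions.
  apply: inj_row_free => u u0; have [c [f [theta [uE u_eq0]]]] := mul_basic_motions u.
  have {}uE v : c + theta *: rot90 (q v) + (v == n)%:R *: f = 0.
    by rewrite -uE u0; apply/rowP=> k; rewrite !mxE.
  have cE v : v != n -> c = - (theta *: rot90 (q v)).
    move=> /negPf vn; apply/eqP; rewrite -addr_eq0; apply/eqP.
    by have := uE v; rewrite vn scale0r addr0.
  have theta0 : theta = 0.
    apply/eqP; apply: contraNT qab => tn0; apply/eqP.
    have := cE a an; rewrite (cE b bn) => /oppr_inj /(scalerI tn0) /rowP rot_ab.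
    have := rot_ab i0; have := rot_ab i1; rewrite !mxE /= => e0 /oppr_inj e1.
    exact: row2P.
  have c0 : c = 0 by rewrite (cE a an) theta0 scale0r oppr0.
  apply: u_eq0 => //; have := uE n.
  by rewrite c0 theta0 scale0r !add0r eqxx scale1r.
have kerN : (basic_motions <= kermx (rigidity_matrix E q)^T)%MS.
  by apply/sub_kermxP; apply: basic_motions_rigidity.
have rank_ker : (\rank (kermx (rigidity_matrix E q)^T) <= \rank basic_motions)%N.
  rewrite (eqP (free_N : \rank _ == _)) mxrank_ker mxrank_tr.
  by rewrite leq_subLR (leq_trans _ rankR) // card_prod card_ord mulnC.
have Qker : ((velocity_col Q)^T <= kermx (rigidity_matrix E q)^T)%MS.
  apply/sub_kermxP; rewrite -trmx_mul; apply/rowP=> e.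
  rewrite mxE rigidity_matrix_mul mxE /=.
  by case: ifP => // /motQ.
have /submxP[u uQ] : ((velocity_col Q)^T <= basic_motions)%MS.
  apply: submx_trans Qker _.
  by have [_ <-] := mxrank_leqif_sup kerN; rewrite eqn_leq mxrankS.
have [c [f [theta [uE _]]]] := mul_basic_motions u.
exists c, theta => v /negPf vn; have := uE v.
rewrite vn scale0r addr0 => <-; rewrite -uQ.
by apply/rowP=> k; rewrite !mxE enum_rankK.
Qed.

End Motions.

(** * Plane geometry of three pairwise non-parallel vectors *)

Definition det2 (F : numFieldType) (u w : 'rV[F]_2) : F :=
  u ord0 i0 * w ord0 i1 - u ord0 i1 * w ord0 i0.

Lemma generic_det2_neq0 (F : numFieldType) (T : finType) (p : T -> 'rV[F]_2)
    (n a b : T) :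
  generic [set: T] p -> n != a -> n != b -> a != b ->
  det2 (p n - p a) (p n - p b) != 0.
Proof.
move=> gen_p na nb ab.
pose x (v : T) k : {mpoly rat[_]} := 'X_(coord_index v k).
pose P := (x n i0 - x a i0) * (x n i1 - x b i1)
  - (x n i1 - x a i1) * (x n i0 - x b i0).
have evP (p' : T -> 'rV[F]_2) :
    ratr_eval (coord_at p') P = det2 (p' n - p' a) (p' n - p' b).
  rewrite /P !(rmorphB (ratr_eval _), rmorphM (ratr_eval _)) !ratr_evalX.
  by rewrite !coord_atE /det2 !mxE.
(* One specialisation suffices: [n] at the origin and [a], [b] at the two unit vectors. *)
pose p0 v : 'rV[F]_2 :=
  (v == a)%:R *: delta_mx ord0 i0 + (v == b)%:R *: delta_mx ord0 i1.
rewrite -evP; apply: (generic_poly_neq0 (p0 := p0)) => //.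
rewrite evP /det2 /p0 !mxE !eqxx (negPf na) (negPf nb) (negPf ab).
rewrite [b == a]eq_sym (negPf ab) /=.
by rewrite (_ : _ - _ = 1) ?oner_neq0 //; ring.
Qed.

(* The linear map [B] with rows [z0], [z1] sends each [Yi] to [Xi].  The
   quadratic form [d (B Y) - d Y] vanishes at [Y1], [Y2] and at [Y3], which is a
   combination of [Y1] and [Y2] with nonzero coefficients, so its polar form
   vanishes at [(Y1, Y2)]. *)
Lemma three_vectors_isometry (F : numFieldType) (X1 X2 X3 Y1 Y2 Y3 z0 z1 : 'rV[F]_2) :
  (forall X Y, (X, Y) \in [:: (X1, Y1); (X2, Y2); (X3, Y3)] ->
    [/\ dot Y z0 = X ord0 i0, dot Y z1 = X ord0 i1 & d X = d Y]) ->
  det2 X1 X3 != 0 -> det2 X3 X2 != 0 -> d (X1 - X2) = d (Y1 - Y2).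
Proof.
move=> XY; have [] := XY X1 Y1; first by rewrite !inE eqxx.
have [] := XY X2 Y2; first by rewrite !inE eqxx orbT.
have [] := XY X3 Y3; first by rewrite !inE eqxx !orbT.
rewrite /d /det2 /dot !mxE.
move=> <- <- dX3 <- <- dX2 <- <- dX1.
set a1 := Y1 _ i0 in dX1 *; set b1 := Y1 _ i1 in dX1 *.
set a2 := Y2 _ i0 in dX2 *; set b2 := Y2 _ i1 in dX2 *.
set a3 := Y3 _ i0 in dX3 *; set b3 := Y3 _ i1 in dX3 *.
set s0 := z0 _ i0 in dX1 dX2 dX3 *; set s1 := z0 _ i1 in dX1 dX2 dX3 *.
set t0 := z1 _ i0 in dX1 dX2 dX3 *; set t1 := z1 _ i1 in dX1 dX2 dX3 *.
move=> D13 D32.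
(* [B] multiplies [det2] by its determinant, so non-parallel images have non-parallel sources. *)
have det_neq0 a b a' b' :
    (a * s0 + b * s1) * (a' * t0 + b' * t1)
    - (a * t0 + b * t1) * (a' * s0 + b' * s1) != 0 -> a * b' - b * a' != 0.
  apply: contraNneq => E; apply/eqP.
  by rewrite -[RHS](mulr0 (s0 * t1 - s1 * t0)) -E; ring.
move: (det_neq0 _ _ _ _ D13) (det_neq0 _ _ _ _ D32) => E13 E32.
pose form a b a' b' := (a * s0 + b * s1) * (a' * s0 + b' * s1)
  + (a * t0 + b * t1) * (a' * t0 + b' * t1) - (a * a' + b * b').
have form0 a b : (a * s0 + b * s1) ^+ 2 + (a * t0 + b * t1) ^+ 2 = a ^+ 2 + b ^+ 2 ->
    form a b a b = 0.
  by move=> E; rewrite /form -!expr2 E subrr.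
have polar : form a1 b1 a2 b2 = 0.
  apply: (mulfI (mulf_neq0 E13 E32)); apply: (@mulfI _ 2); first by rewrite pnatr_eq0.
  rewrite !mulr0.
  (* Cramer's rule [det2 Y1 Y2 *: Y3 = det2 Y3 Y2 *: Y1 + det2 Y1 Y3 *: Y2], inserted in the
     quadratic form. *)
  have -> : 2 * ((a1 * b3 - b1 * a3) * (a3 * b2 - b3 * a2) * form a1 b1 a2 b2) =
      (a1 * b2 - b1 * a2) ^+ 2 * form a3 b3 a3 b3
      - (a3 * b2 - b3 * a2) ^+ 2 * form a1 b1 a1 b1
      - (a1 * b3 - b1 * a3) ^+ 2 * form a2 b2 a2 b2 by rewrite /form; ring.
  by rewrite !form0 // !mulr0 !subr0.
apply/eqP; rewrite -subr_eq0; apply/eqP.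
transitivity (form a1 b1 a1 b1 + form a2 b2 a2 b2 - 2 * form a1 b1 a2 b2).
  by rewrite /form; ring.
by rewrite !form0 // polar mulr0 subr0 addr0.
Qed.

(** * Distances between the neighbours of the deleted vertex *)

Section Extension.
Variables (F : numFieldType) (T : finType) (E : rel T) (n : T).
Variables (p q : T -> 'rV[F]_2).
Hypotheses (Eirr : irreflexive E) (gen_p : generic [set: T] p).
Hypothesis eq_pq : equivalent E p q.
Hypothesis T_gt : (5 < 2 * #|T|)%N.
Hypothesis rankR : (2 * #|T| <= \rank (rigidity_matrix (del_vertex E n) q) + 5)%N.

(* Differentiate along the motion of [p] that moves only [n], in direction [k];
   the response of [q] is a rigid motion off [n], which can be subtracted. *)
Lemma neighbour_coord_dot (k : 'I_2) :
  exists z, forall w, E n w -> dot (q n - q w) z = (p n - p w) ord0 k.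
Proof.
pose P v : 'rV[F]_2 := (v == n)%:R *: delta_mx ord0 k.
have [Q PQ] := generic_first_order P gen_p eq_pq.
have del_n a b : del_vertex E n a b -> a != n /\ b != n by case/and3P.
have motQ a b : del_vertex E n a b -> dot (q a - q b) (Q a - Q b) = 0.
  case/and3P=> Eab /negPf an /negPf bn.
  by rewrite -PQ // /P an bn scale0r subrr /dot !mxE !mulr0 addr0.
have [c [theta QE]] := motion_trivial del_n T_gt rankR motQ.
exists (Q n - c - theta *: rot90 (q n)) => w Enw.
have wn : w != n by apply: contraTneq Enw => ->; rewrite Eirr.
have := PQ n w Enw; rewrite (QE w wn) /P eqxx (negPf wn) scale0r scale1r subr0.
have -> : dot (p n - p w) (delta_mx ord0 k) = (p n - p w) ord0 k.
  rewrite /dot !mxE; case: (unliftP i0 k) => [j|] -> /=; last by ring.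
  by rewrite (ord1 j) /=; ring.
(* The rotational term drops out, since [rot90] of a vector is orthogonal to that vector. *)
by move=> ->; rewrite /dot !mxE /=; ring.
Qed.

Lemma neighbours_dist (v1 v2 v3 : T) :
  v1 != v3 -> v2 != v3 -> E n v1 -> E n v2 -> E n v3 ->
  d (p v1 - p v2) = d (q v1 - q v2).
Proof.
move=> n13 n23 E1 E2 E3.
have [z0 z0E] := neighbour_coord_dot i0; have [z1 z1E] := neighbour_coord_dot i1.
have nE w : E n w -> n != w by apply: contraTneq => <-; rewrite Eirr.
have diff (r : T -> 'rV[F]_2) : r v1 - r v2 = (r n - r v2) - (r n - r v1).
  by apply/rowP=> k; rewrite !mxE; ring.
rewrite (diff p) (diff q).
apply: (@three_vectors_isometry _ _ _ (p n - p v3) _ _ (q n - q v3) z0 z1).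
- move=> X Y; rewrite !inE => /or3P[] /eqP[-> ->];
    by rewrite z0E // z1E //; split=> //; apply: eq_pq.
- by apply: generic_det2_neq0; rewrite ?nE.
- by apply: generic_det2_neq0; rewrite ?nE // eq_sym.
Qed.

End Extension.

Theorem theorem7p2 (T : finType) (E : rel T)
    (Esym : symmetric E) (Eirr : irreflexive E)
    (p : T -> 'rV[CC]_2) (u v v1 v2 v3 vn : T) :
  generic [set: T] p ->
  v1 != v2 -> v1 != v3 -> v2 != v3 ->
  (forall w, E vn w = (w \in [set v1; v2; v3])) ->
  vn != u -> vn != v ->
  rigid [set~ vn] (del_vertex E vn) ->
  globally_linked (add_edge (del_vertex E vn) v1 v2) p u v ->
  globally_linked E p u v.
Proof.
move=> gen_p n12 n13 n23 Evn _ _ [p0 [_ rank_p0]] linked q eq_pq.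
have [E1 E2 E3] : [/\ E vn v1, E vn v2 & E vn v3].
  by rewrite !Evn !inE !eqxx !orbT.
have eq_pq' : equivalent (del_vertex E vn) p q.
  by move=> a b /and3P[Eab _ _]; apply: eq_pq.
(* Four distinct vertices make the truncated subtraction in [rigid] a true one: the rank is
   [2 * #|T| - 5]. *)
have cardT : (3 < #|T|)%N.
  rewrite cardE; apply: (@uniq_leq_size _ [:: vn; v1; v2; v3]) => [|x _]; last first.
    by rewrite mem_enum.
  have nE w : E vn w -> vn != w by apply: contraTneq => <-; rewrite Eirr.
  by rewrite /= !inE !negb_or n12 n13 n23 !nE.
have rank_q : (2 * #|T| <= \rank (rigidity_matrix (del_vertex E vn) q) + 5)%N.
  have := rank_rigidity_generic (del_vertex E vn) p0 gen_p.
  have := rank_rigidity_equivalent gen_p eq_pq'.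
  rewrite rank_p0 cardsC1; move: cardT.
  set rp := \rank _; set rq := \rank _; lia.
have dist12 : d (p v1 - p v2) = d (q v1 - q v2).
  by apply: (@neighbours_dist _ _ E vn p q _ _ _ _ _ v1 v2 v3) => //; lia.
(* Only the added edge, in its two orientations, needs [dist12]. *)
apply: linked => a b /or3P[/eq_pq'//|/andP[/eqP-> /eqP->]//|/andP[/eqP-> /eqP->]].
have dC (r : T -> 'rV[CC]_2) : d (r v2 - r v1) = d (r v1 - r v2).
  by rewrite /d !mxE; ring.
by rewrite !dC.
Qed.
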